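(* Let $(u_n)_{n\ge0}$ be defined by $u_0=1$ and $u_{n+1}=u_n(u_n+1)$, and set $c_0=\lim_{n\to\infty}u_n^{2^{-n}}$. (1) For every $\varepsilon>0$ there is a constant $C_\varepsilon>0$ such that for all $k\in\mathbb{N}$ $$f_k(1,1)\le C_\varepsilon\,k^{\frac{2}{15}\cdot2^{k-1}+\varepsilon}.$$ (2) For every $\varepsilon>0$ there is $k(\varepsilon)$ such that for all $k\ge k(\varepsilon)$ $$f_k(1,1)<c_0^{\left(\frac25+\varepsilon\right)2^{k-1}}.$$ (3) For every $\varepsilon>0$ there is $k(\varepsilon)$ such that for all $k\ge k(\varepsilon)$ the number of positive integer solutions $(a_1,\ldots,a_k)\in\mathbb{N}^k$ of the equation $$1=\sum_{i=1}^k\frac1{a_i}+\frac{1}{\prod_{i=1}^ka_i}$$ is bounded from above by $c_0^{\left(\frac25+\varepsilon\right)2^k}$.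
   Context: $\mathbb{N}$ denotes the positive integers. For $k,m,n\in\mathbb{N}$, $$f_k(m,n)=\left|\left\{(a_1,\ldots,a_k)\in\mathbb{N}^k:\ a_1\le\cdots\le a_k,\ \frac{m}{n}=\sum_{i=1}^k\frac1{a_i}\right\}\right|.$$ The limit $c_0=1.5979102\ldots$ is known to exist. *)

(* Defs.v *)
From HB Require Import structures.
From mathcomp Require Export all_boot all_order all_algebra finmap.
From mathcomp Require Export mathcomp_extra boolp classical_sets functions
  cardinality reals topology normedtype sequences exp.

Set Implicit Arguments.
Unset Strict Implicit.
Unset Printing Implicit Defensive.

Export Order.TTheory GRing.Theory Num.Theory.
Export numFieldNormedType.Exports.

Local Open Scope classical_set_scope.
Local Open Scope ring_scope.

Definition pos_tuple k (a : k.-tuple nat) : Prop :=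
  forall i : 'I_k, (0 < tnth a i)%N.

Definition unit_sum k (a : k.-tuple nat) : rat :=
  \sum_(i < k) (tnth a i)%:R^-1.

(* Meaningful for 0 < n only, since _ / 0 = 0. *)
Definition unit_fraction_solutions (k m n : nat) : set (k.-tuple nat) :=
  [set a | [/\ pos_tuple a, sorted leq a & m%:R / n%:R = unit_sum a]].

Definition product_equation_solutions (k : nat) : set (k.-tuple nat) :=
  [set a | pos_tuple a /\
     1 = unit_sum a + (\prod_(i < k) (tnth a i)%:R)^-1].

(* [fset_set] returns the empty set on infinite sets; both solution sets are
   shown below to be finite, so that these are the genuine cardinalities. *)
Definition f_ (k m n : nat) : nat :=
  #|` fset_set (@unit_fraction_solutions k m n)|%fset.

Definition product_equation_count (k : nat) : nat :=
  #|` fset_set (@product_equation_solutions k)|%fset.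

Fixpoint u_ (n : nat) : nat :=
  if n is n'.+1 then (u_ n' * (u_ n' + 1))%N else 1%N.

Definition c0_seq (R : realType) (n : nat) : R := (u_ n)%:R `^ (2 ^- n).

(* The limit exists: see [is_cvg_c0_seq] below. *)
Definition c0 (R : realType) : R := limn (@c0_seq R).

Lemma unit_fractions_bounded (k : nat) (q : rat) : exists B : nat,
  forall s : seq nat, size s = k -> all (leq 1) s ->
    \sum_(a <- s) a%:R^-1 = q -> all (leq^~ B) s.
Proof.
elim: k q => [|k IH] q.
  by exists 0%N => s /size0nil ->.
have [B HB] := choice IH.
have [q_le0|q_gt0] := leP q 0.
  exists 0%N => -[//|a s] _ /= /andP[a_gt0 s_gt0] eq_q.
  suff : 0 < q by rewrite ltNge q_le0.
  rewrite -eq_q big_cons ltr_wpDr ?invr_gt0 ?ltr0n//.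
  by apply: sumr_ge0 => i _; rewrite invr_ge0.
pose N := Num.bound (k.+1%:R / q).
exists (maxn N (\max_(a < N.+1) B (q - a%:R^-1)%R)) => s size_s s_gt0 eq_q.
have /hasP[a a_s a_le] : has (leq^~ N) s.
  apply/negPn/negP; rewrite -all_predC => /allP /= s_gtN.
  have /archi_boundP : 0 <= k.+1%:R / q by rewrite divr_ge0 ?ltW.
  rewrite -/N ltNge => /negP; apply.
  have N_gt0 : (0 < N)%N.
    rewrite -(ltr0n rat); apply: le_lt_trans (archi_boundP _).
      by rewrite divr_ge0 ?ltW.
    by rewrite divr_ge0 ?ltW.
  rewrite ler_pdivlMr// -ler_pdivlMl ?ltr0n// -eq_q mulrC.
  rewrite -size_s -sum1_size natr_sum mulr_suml.
  rewrite big_seq [leRHS]big_seq; apply: ler_sum => i /s_gtN.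
  rewrite -ltnNge => iN; rewrite mul1r lef_pV2 ?posrE ?ltr0n ?(leq_trans _ iN)//.
  by rewrite ler_nat ltnW.
have s_perm := perm_to_rem a_s.
have rem_gt0 : all (leq 1) (rem a s).
  by apply/allP => x /mem_rem /(allP s_gt0).
have size_rem_s : size (rem a s) = k by rewrite size_rem// size_s.
have sum_rem : \sum_(x <- rem a s) x%:R^-1 = q - a%:R^-1.
  by rewrite -eq_q (perm_big _ s_perm) big_cons/= addrC addrK.
rewrite (perm_all _ s_perm) /= leq_max a_le /=.
apply: sub_all (HB _ _ size_rem_s rem_gt0 sum_rem) => x xB.
have aN : (a < N.+1)%N by [].
rewrite leq_max; apply/orP; right; apply: leq_trans xB _.
exact: (leq_bigmax (F := fun i : 'I_N.+1 => B (q - i%:R^-1)%R) (Ordinal aN)).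
Qed.

Lemma finite_bounded_tuples (k B : nat) (A : set (k.-tuple nat)) :
  (forall a, A a -> all (leq^~ B) a) -> finite_set A.
Proof.
move=> AB; pose g (t : k.-tuple 'I_B.+1) := map_tuple (@nat_of_ord _) t.
apply: (@sub_finite_set _ _ (g @` setT)); last first.
  exact/finite_image/finite_finset.
move=> a /AB /allP aB; exists (map_tuple inord a) => //.
apply: val_inj; rewrite /= -map_comp -[RHS]map_id; apply/eq_in_map => x xa /=.
by rewrite inordK// ltnS aB.
Qed.

Lemma unit_sumE k (a : k.-tuple nat) : unit_sum a = \sum_(x <- a) x%:R^-1.
Proof. by rewrite big_tuple. Qed.

Lemma pos_tupleP k (a : k.-tuple nat) : pos_tuple a -> all (leq 1) a.
Proof. by move=> a_gt0; apply/all_tnthP => i; exact: a_gt0. Qed.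

Lemma finite_unit_fraction_solutions (k m n : nat) :
  finite_set (@unit_fraction_solutions k m n).
Proof.
have [B HB] := unit_fractions_bounded k (m%:R / n%:R).
apply: (@finite_bounded_tuples _ B) => a [/pos_tupleP a_gt0 _ eqa].
by apply: HB => //; rewrite ?size_tuple// eqa unit_sumE.
Qed.

Lemma finite_product_equation_solutions (k : nat) :
  finite_set (@product_equation_solutions k).
Proof.
have [B HB] := unit_fractions_bounded k.+1 1.
apply: (@finite_bounded_tuples _ B) => a [a_gt0 eqa].
suff /andP[] : all (leq^~ B) ((\prod_(i < k) tnth a i)%N :: a) by [].
apply: HB; first by rewrite /= size_tuple.
  by rewrite /= pos_tupleP// prodn_gt0.
by rewrite big_cons -unit_sumE natr_prod addrC -eqa.
Qed.

Lemma u_gt0 n : (0 < u_ n)%N.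
Proof. by elim: n => //= n IH; rewrite muln_gt0 IH addn1. Qed.

Lemma u_lt n : (u_ n < 2 ^ 2 ^ n)%N.
Proof.
elim: n => //= n IH; rewrite expnSr expnM expnS expn1.
apply: (@leq_trans ((u_ n).+1 * (u_ n).+1)); last by rewrite leq_mul.
by rewrite addn1 mulSn addSn ltnS leq_addl.
Qed.

Lemma is_cvg_c0_seq (R : realType) : cvgn (@c0_seq R).
Proof.
have expE n : 2 ^- n = 2%:R * 2 ^- n.+1 :> R.
  by rewrite exprS invfM mulrA divff ?mul1r ?pnatr_eq0.
apply: nondecreasing_is_cvgn.
  apply/nondecreasing_seqP => n; rewrite /c0_seq expE powRrM powR_mulrn//.
  rewrite ge0_ler_powR ?nnegrE ?invr_ge0 ?exprn_ge0//.
  by rewrite -natrX ler_nat /= expnS expn1 leq_mul ?leq_addr.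
exists 2 => _ [n _ <-]; rewrite /c0_seq.
apply: (@le_trans _ _ ((2 ^ 2 ^ n)%:R `^ (2 ^- n))).
  by rewrite ge0_ler_powR ?nnegrE ?invr_ge0 ?exprn_ge0// ler_nat ltnW// u_lt.
rewrite natrX -powR_mulrn// -powRrM natrX divff ?powRr1//.
by rewrite expf_neq0// pnatr_eq0.
Qed.

(* Main.v *)
(**
  A solution of length k = j + 4 is a prefix a_1 <= ... <= a_j followed by a
  tail a <= b <= x <= y. By Curtiss' theorem a sum of i unit fractions below 1
  is at most 1 - 1/u_i, hence a_(i+1) <= k * u_i, and both the number of
  prefixes and the product n of a prefix are at most X := k^j * u_j. The
  remainder of the prefix is m/n. Put m1 := m a - n and N := m1 b; then
  N <= 12 n^2 and m1 divides N, so the pair (a, b) is encoded by N and a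
  divisor of N. With m2/n2 the remainder after b, n2 = n a b <= 48 n^4, the
  identity (m2 x - n2) (m2 y - n2) = n2^2 encodes (x, y) by a divisor of n2^2.
  By the divisor bound the number of solutions is X^(3 + o(1)), and as
  u_j <= c0^(2^j) this is c0^((3/8 + o(1)) 2^(k - 1)), which is more than
  enough for part 2. Part 1 follows since c0 <= 2 <= k^(1/3) for k >= 8; part 3
  follows since sorting (a_1, ..., a_k) and appending the product of the a_i
  gives a solution of the unit fraction equation with k + 1 terms.
*)
Require Import Defs.
From mathcomp Require Import zify ring lra.

Set Implicit Arguments.
Unset Strict Implicit.
Unset Printing Implicit Defensive.

Local Open Scope nat_scope.

(** * The divisor bound *)

Lemma leq_expl m n e : m <= n -> m ^ e <= n ^ e.
Proof. by case: e => // e le_mn; rewrite leq_exp2r. Qed.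

(** A divisor splits into its [p]-part, one of [e.+1] powers of [p], and its [p']-part, which
    divides [m]. *)
Lemma size_divisors_pfactor p e m : prime p -> 0 < m -> coprime p m ->
  size (divisors (p ^ e * m)) <= e.+1 * size (divisors m).
Proof.
move=> p_pr m_gt0 co_pm; have p_gt0 := prime_gt0 p_pr.
pose L := [seq p ^ i * d | i <- iota 0 e.+1, d <- divisors m].
have -> : e.+1 * size (divisors m) = size L by rewrite size_allpairs size_iota.
apply: uniq_leq_size (divisors_uniq _) _ => d.
rewrite -dvdn_divisors ?muln_gt0 ?expn_gt0 ?p_gt0// => d_dvd.
have d_gt0 : 0 < d by apply: dvdn_gt0 d_dvd; rewrite muln_gt0 expn_gt0 p_gt0.
rewrite -(partnC p d_gt0) p_part; apply: allpairs_f.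
  rewrite mem_iota leq0n add0n ltnS -(dvdn_Pexp2l _ _ (prime_gt1 p_pr)) -p_part.
  have : coprime d`_p m by rewrite p_part; apply: coprimeXl.
  move=> co; rewrite -(Gauss_dvdl _ co); exact: dvdn_trans (dvdn_part _ _) d_dvd.
rewrite -dvdn_divisors//.
have co : coprime d`_p^' (p ^ e).
  rewrite coprime_sym; apply: pnat_coprime (part_pnat _ _).
  by rewrite pnatX pnat_id.
by rewrite -(Gauss_dvdr _ co); exact: dvdn_trans (dvdn_part _ _) d_dvd.
Qed.

(** With [q := e %/ t] one has [e.+1 <= t * q.+1 <= t * 2 ^ q], and [q * t <= e]. *)
Lemma expn_succ_le t e : 0 < t -> e.+1 ^ t <= t ^ t * 2 ^ e.
Proof.
move=> t_gt0; apply: (@leq_trans ((t * 2 ^ (e %/ t)) ^ t)).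
  rewrite leq_exp2r//; apply: leq_trans (ltn_ceil e t_gt0) _.
  by rewrite mulnC leq_mul2l ltn_expl ?orbT.
by rewrite expnMn leq_mul2l -expnM leq_exp2l// leq_trunc_div orbT.
Qed.

(** Compare prime power by prime power. If [p >= 2 ^ t] then [e.+1 ^ t <= p ^ e] outright; each of
    the fewer than [2 ^ t] smaller primes costs a factor [t ^ t] by [expn_succ_le]. *)
Lemma divisor_bound t : 0 < t ->
  exists C, forall n, 0 < n -> size (divisors n) ^ t <= C * n.
Proof.
move=> t_gt0; pose A := t ^ t; have A_gt0 : 0 < A by rewrite expn_gt0 t_gt0.
(* Induction on a strict bound [b] for the prime factors. The exponent [minn b (2 ^ t)] bounds the
   number of small primes met so far, so the constant stays below [A ^ 2 ^ t] for every [b]. *)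
suff H b n : 0 < n -> (forall p, prime p -> p %| n -> p < b) ->
    size (divisors n) ^ t <= A ^ minn b (2 ^ t) * n.
  exists (A ^ 2 ^ t) => n n_gt0; apply: leq_trans (H n.+1 n n_gt0 _) _.
    by move=> p _ /dvdn_leq; rewrite ltnS; exact.
  by rewrite leq_mul2r leq_pexp2l ?geq_minr ?orbT.
elim: b n => [|b IH] n n_gt0 n_lt.
  case: n n_gt0 n_lt => [//|[|n]] _ n_lt; first by rewrite exp1n min0n.
  by have := n_lt (pdiv n.+2) (@pdiv_prime n.+2 isT) (pdiv_dvd _).
have [b_pr|b_npr] := boolP (prime b); last first.
  apply: leq_trans (IH _ n_gt0 _) _.
    move=> p p_pr p_n; have := n_lt p p_pr p_n; rewrite ltnS leq_eqVlt.
    by case: eqP => // eq_pb; rewrite -eq_pb p_pr in b_npr.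
  by rewrite leq_mul2r leq_pexp2l ?orbT// leq_min geq_minr geq_min leqnSn.
set m := n`_b^'; set e := logn b n.
have n_eq : n = b ^ e * m by rewrite -p_part partnC.
have m_gt0 : 0 < m by rewrite part_gt0.
have co_bm : coprime b m.
  by apply: pnat_coprime (part_pnat _ _); rewrite pnat_id.
have {}IH : size (divisors m) ^ t <= A ^ minn b (2 ^ t) * m.
  apply: IH => // p p_pr p_m.
  have : p < b.+1 by apply: n_lt => //; apply: dvdn_trans p_m (dvdn_part _ _).
  rewrite ltnS leq_eqVlt => /orP[/eqP eq_pb|//].
  by move: co_bm; rewrite prime_coprime// -eq_pb p_m.
have e_le : e.+1 ^ t * A ^ minn b (2 ^ t) <= A ^ minn b.+1 (2 ^ t) * b ^ e.
  have [le_tb|lt_bt] := leqP (2 ^ t) b.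
    rewrite (minn_idPr (leqW le_tb)) mulnC leq_mul2l; apply/orP; right.
    apply: (@leq_trans ((2 ^ t) ^ e)); last exact: leq_expl.
    by rewrite -expnM mulnC expnM leq_exp2r// ltn_expl.
  rewrite (minn_idPl lt_bt) expnSr mulnC -mulnA leq_mul2l.
  apply/orP; right; apply: leq_trans (expn_succ_le e t_gt0) _.
  by rewrite leq_mul2l leq_expl ?prime_gt1// orbT.
apply: (@leq_trans ((e.+1 * size (divisors m)) ^ t)).
  by rewrite leq_exp2r// {1}n_eq size_divisors_pfactor.
rewrite expnMn n_eq mulnA; apply: leq_trans (leq_mul e_le (leqnn m)).
by rewrite -mulnA leq_mul2l IH orbT.
Qed.

Local Open Scope ring_scope.

(** * Curtiss' theorem *)

(** The [u_ i + 1] form Sylvester's sequence 2, 3, 7, 43, ...; the sum telescopes by 1/(u + 1) = 1/u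
    - 1/(u (u + 1)). *)
Lemma u_sum (n : nat) : \sum_(i < n) (u_ i + 1)%:R^-1 = 1 - (u_ n)%:R^-1 :> rat.
Proof.
elim: n => [|n IH]; first by rewrite big_ord0 invr1 subrr.
rewrite big_ord_recr /= IH natrM natrD.
have u_gt : 0 < (u_ n)%:R :> rat by rewrite ltr0n u_gt0.
field; apply/andP; split; lra.
Qed.

Lemma u_prod (n : nat) : (\prod_(i < n) (u_ i + 1) = u_ n)%N.
Proof. by elim: n => [|n IH]; rewrite ?big_ord0// big_ord_recr /= IH. Qed.

Lemma AGM_gt1 (F : realFieldType) n (z : 'I_n -> F) :
  (forall i, 0 < z i) -> 1 < \prod_i z i -> n%:R < \sum_i z i.
Proof.
move=> z_gt0 prod_gt1; have n_gt0 : (0 < n)%N.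
  by case: n z z_gt0 prod_gt1 => // z _; rewrite big_ord0 ltxx.
have := leif_AGM (A := predT) (E := z) (fun i _ => ltW (z_gt0 i)).
rewrite cardT size_enum_ord => -[/(lt_le_trans prod_gt1) + _].
rewrite !ltNge; apply: contra => le_n; apply: exprn_ile1.
  by rewrite divr_ge0// sumr_ge0// => i _; exact: ltW.
by rewrite ler_pdivrMr ?ltr0n// mul1r.
Qed.

(** Summation by parts: as [a] increases and the partial sums of [w] are nonnegative, replacing the
    weights so far by the next one, [a i], can only increase the sum. At the end the weight is
    constant and the total of [w] is at most 0. *)
Lemma abel_le0 (F : realFieldType) (a w : nat -> F) n :
  0 <= a 0%N -> (forall i, (i.+1 < n)%N -> a i <= a i.+1) ->
  (forall i, (i < n)%N -> 0 <= \sum_(l < i) w l) -> \sum_(l < n) w l <= 0 ->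
  \sum_(l < n) a l * w l <= 0.
Proof.
case: n => [|n] a0 a_mono w_ge0; first by rewrite !big_ord0.
have H i : (i <= n)%N ->
    0 <= a i /\ \sum_(l < i) a l * w l <= a i * \sum_(l < i) w l.
  elim: i => [|i IH] i_le; first by rewrite !big_ord0 mulr0.
  have [ai_ge0 le_i] := IH (ltnW i_le); have le_a := a_mono i i_le.
  split; first exact: le_trans le_a.
  have := w_ge0 i.+1 i_le; rewrite !big_ord_recr /= => w_i.
  apply: le_trans (ler_wpM2r w_i le_a).
  by rewrite mulrDr lerD2r.
have [an_ge0 le_n] := H n (leqnn n); rewrite !big_ord_recr /= => w_le0.
apply: (@le_trans _ _ (a n * (\sum_(l < n) w l + w n))).
  by rewrite mulrDr lerD2r.
by rewrite mulr_ge0_le0.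
Qed.

(** With P the product of the [a i], a sum c/P below 1 falls short of 1 by at least 1/P. *)
Lemma unit_sum_num n (a : nat -> nat) : (forall i, i < n -> 0 < a i)%N ->
  exists c : nat, \sum_(i < n) (a i)%:R^-1 = c%:R / (\prod_(i < n) a i)%N%:R :> rat.
Proof.
elim: n => [|n IH] a_gt0; first by exists 0%N; rewrite !big_ord0 mul0r.
have [|c eq_c] := IH; first by move=> i /ltnW; apply: a_gt0.
exists (c * a n + \prod_(i < n) a i)%N.
rewrite !big_ord_recr /= eq_c natrD !natrM.
have : (0 < \prod_(i < n) a i)%N.
  by rewrite prodn_gt0// => i; apply: a_gt0; apply: ltnW; rewrite ltnS.
have : (0 < a n)%N by apply: a_gt0.
rewrite -!(ltr0n rat) => /gt_eqF + /gt_eqF.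
by move=> /negbT an /negbT pn; field; rewrite an pn.
Qed.

(* Soundararajan's proof: let the sum for [a] exceed that for [u_ i + 1] at the
   least [n]. Then [\prod a_i > u_ n = \prod (u_ i + 1)], so by AM-GM
   [\sum a_i / (u_ i + 1) > n], that is [\sum a_i * w_i > 0] for
   [w_i := 1 / (u_ i + 1) - 1 / a_i], whereas Abel summation makes it [<= 0]. *)
Lemma unit_sum_lt1_le n (a : nat -> nat) :
  (forall i, i < n -> 0 < a i)%N -> (forall i, i.+1 < n -> a i <= a i.+1)%N ->
  \sum_(i < n) (a i)%:R^-1 < 1 :> rat ->
  \sum_(i < n) (a i)%:R^-1 <= 1 - (u_ n)%:R^-1 :> rat.
Proof.
elim/ltn_ind: n => n IH a_gt0 a_mono sum_lt1.
have [//|sum_gt] := leP; exfalso.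
have partial m : (m < n)%N -> \sum_(i < m) (a i)%:R^-1 <= 1 - (u_ m)%:R^-1 :> rat.
  move=> m_n; apply: IH => // [i im|i im|]; first 2 last.
  - apply: le_lt_trans sum_lt1.
    rewrite -(subnKC (ltnW m_n)) big_split_ord /= lerDl sumr_ge0// => i _.
    by rewrite invr_ge0.
  - by apply: a_gt0; lia.
  - by apply: a_mono; lia.
have P_gt0 : (0 < \prod_(i < n) a i)%N by rewrite prodn_gt0// => i; exact: a_gt0.
have prod_gt : (u_ n < \prod_(i < n) a i)%N.
  have [c eq_c] := unit_sum_num a_gt0.
  move: sum_lt1 sum_gt; rewrite eq_c ltr_pdivrMr ?ltr0n// mul1r ltr_nat => c_lt.
  set P := (\prod_(i < n) a i)%N in P_gt0 c_lt *.
  rewrite ltrBlDr -ltrBlDl -(ltr_nat rat).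
  have -> : 1 - c%:R / P%:R = (P - c)%:R / P%:R :> rat.
    by rewrite natrB ?(ltnW c_lt)// mulrBl divff// pnatr_eq0; lia.
  move=> lt_u; rewrite -ltf_pV2 ?posrE ?ltr0n ?u_gt0//; apply: le_lt_trans lt_u.
  by rewrite ler_peMl ?invr_ge0// ler1n subn_gt0.
have a_gt0' (i : 'I_n) : 0 < (a i)%:R :> rat by rewrite ltr0n; exact: a_gt0.
have : n%:R < \sum_(i < n) (a i)%:R / (u_ i + 1)%:R :> rat.
  apply: AGM_gt1 => [i|]; first by rewrite divr_gt0// ltr0n addn1.
  rewrite prodf_div -!natr_prod u_prod ltr_pdivlMr ?ltr0n ?u_gt0//.
  by rewrite mul1r ltr_nat.
have -> : n%:R = \sum_(i < n) (a i)%:R / (a i)%:R :> rat.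
  rewrite (eq_bigr (fun=> 1)) ?sumr_const ?card_ord// => i _.
  by rewrite divff// gt_eqF.
rewrite -subr_gt0 -sumrB; under eq_bigr do rewrite -mulrBr.
apply/negP; rewrite -leNgt.
apply: (@abel_le0 _ (fun i => (a i)%:R) (fun i => (u_ i + 1)%:R^-1 - (a i)%:R^-1)).
- by [].
- by move=> i i_n; rewrite ler_nat a_mono.
- by move=> i i_n; rewrite sumrB subr_ge0 u_sum partial.
- by rewrite sumrB subr_le0 u_sum ltW.
Qed.

(** * Encoding the solutions *)

(** Codes of solutions are counted as members of a box; entries start at 1, so that its size is
    exactly the product of the bounds. *)
Fixpoint box (bs : seq nat) : seq (seq nat) :=
  if bs is b :: bs' then [seq x :: s | x <- iota 1 b, s <- box bs']
  else [:: [::]].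

Lemma size_box bs : size (box bs) = (\prod_(b <- bs) b)%N.
Proof.
elim: bs => [|b bs IH]; first by rewrite big_nil.
by rewrite big_cons /= size_allpairs size_iota IH.
Qed.

Lemma mem_box bs s :
  (s \in box bs) = all2 (fun x b => 0 < x <= b)%N s bs.
Proof.
elim: bs s => [|b bs IH] [|x s] //=.
  by apply/negbTE/negP => /allpairsP[] [? ?] [].
rewrite -IH; apply/allpairsP/andP => [[[y t] /= [+ t_in [-> ->]]]|[x_b s_in]].
  by rewrite mem_iota add1n ltnS.
by exists (x, s); rewrite mem_iota add1n ltnS.
Qed.

Lemma card_fset_set_le (T : choiceType) (U : eqType) (A : set T) (g : T -> U)
    (L : seq U) : finite_set A -> (forall x, A x -> g x \in L) ->
  (forall x y, A x -> A y -> g x = g y -> x = y) ->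
  (#|` fset_set A|%fset <= size L)%N.
Proof.
move=> A_fin gL g_inj; rewrite -(size_map g); apply: uniq_leq_size.
  rewrite map_inj_in_uniq ?fset_uniq// => x y.
  by rewrite !in_fset_set// !inE => Ax Ay; exact: g_inj.
by move=> _ /mapP[x + ->]; rewrite in_fset_set// inE => /gL.
Qed.

(* [q] stands for the fraction [q.1 / q.2] and [subfrac q a] for
   [q.1 / q.2 - 1 / a], left unreduced so that the denominators are products
   of the [a_i]; the subtraction truncates if this is negative. *)
Definition subfrac (q : nat * nat) (a : nat) : nat * nat :=
  ((q.1 * a - q.2)%N, (q.2 * a)%N).

(** Since the remainder [r] is positive, the truncated subtraction in [subfrac] is exact. *)
Lemma subfracP m n a (r : rat) : (0 < n)%N -> (0 < a)%N -> 0 < r ->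
  m%:R / n%:R = a%:R^-1 + r ->
  (n < m * a)%N /\ (m * a - n)%N%:R / (n * a)%N%:R = r.
Proof.
move=> n_gt0 a_gt0 r_gt0 eq_mn.
have nP : 0 < n%:R :> rat by rewrite ltr0n.
have aP : 0 < a%:R :> rat by rewrite ltr0n.
have r_eq : r = m%:R / n%:R - a%:R^-1 by rewrite eq_mn; ring.
have lt_nma : (n < m * a)%N.
  rewrite -(ltr_nat rat) natrM -subr_gt0.
  have -> : m%:R * a%:R - n%:R = r * (n%:R * a%:R) :> rat.
    by rewrite r_eq; field; rewrite ?gt_eqF.
  by rewrite !mulr_gt0.
split=> //; rewrite natrB ?(ltnW lt_nma)// !natrM r_eq.
by field; rewrite ?gt_eqF.
Qed.

(** Positivity of the final remainder makes all intermediate ones positive, so [subfracP] applies at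
    each step. *)
Lemma foldl_subfrac p m n (r : rat) : (0 < n)%N -> all (leq 1) p -> 0 < r ->
  m%:R / n%:R = \sum_(a <- p) a%:R^-1 + r ->
  let q := foldl subfrac (m, n) p in
  [/\ (0 < q.1)%N, q.2 = (n * \prod_(a <- p) a)%N & q.1%:R / q.2%:R = r].
Proof.
elim: p m n => [|a p IH] m n n_gt0 /=.
  rewrite !big_nil muln1 add0r => _ r_gt0 eq_r; split=> //.
  by move: r_gt0; rewrite -eq_r; case: m {eq_r} => //; rewrite mul0r ltxx.
move=> /andP[a_gt0 p_gt0] r_gt0; rewrite !big_cons -addrA => eq_mn.
have sum_gt0 : 0 < \sum_(a <- p) a%:R^-1 + r.
  by rewrite ltr_wpDl// sumr_ge0// => i _; rewrite invr_ge0.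
have [_ eq_r] := subfracP n_gt0 a_gt0 sum_gt0 eq_mn.
by rewrite mulnA; apply: IH => //; rewrite muln_gt0 n_gt0.
Qed.

Lemma le_first_denominator (s : seq nat) (a m n : nat) :
  (0 < n)%N -> (0 < a)%N -> all (leq a) s ->
  m%:R / n%:R = \sum_(x <- s) x%:R^-1 :> rat -> (m * a <= size s * n)%N.
Proof.
move=> n_gt0 a_gt0 /allP s_ge eq_mn.
rewrite -(ler_nat rat) !natrM -ler_pdivlMr ?ltr0n// -mulrAC -ler_pdivrMr ?ltr0n//.
rewrite eq_mn mulrC -sum1_size natr_sum mulr_sumr big_seq [leRHS]big_seq.
apply: ler_sum => x /s_ge le_ax; rewrite mulr1 lef_pV2 ?posrE ?ltr0n ?ler_nat//.
exact: leq_trans le_ax.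
Qed.

Lemma two_unit_fractions m n x y :
  (0 < n)%N -> (0 < x)%N -> (0 < y)%N ->
  m%:R / n%:R = x%:R^-1 + y%:R^-1 :> rat -> (m * x - n %| n ^ 2)%N.
Proof.
move=> n_gt0 x_gt0 y_gt0 eq_mn; have eq_mn' := eq_mn; rewrite addrC in eq_mn'.
have inv_gt0 z : (0 < z)%N -> 0 < z%:R^-1 :> rat by rewrite invr_gt0 ltr0n.
have [/ltnW le_x _] := subfracP n_gt0 x_gt0 (inv_gt0 y y_gt0) eq_mn.
have [/ltnW le_y _] := subfracP n_gt0 y_gt0 (inv_gt0 x x_gt0) eq_mn'.
suff -> : (n ^ 2 = (m * x - n) * (m * y - n))%N by rewrite dvdn_mulr.
apply/eqP; rewrite -(eqr_nat rat) natrX !natrM !natrB// !natrM.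
have -> : m%:R = (x%:R^-1 + y%:R^-1) * n%:R :> rat.
  by rewrite -eq_mn divfK// pnatr_eq0 -lt0n.
apply/eqP; field; rewrite !pnatr_eq0; lia.
Qed.

(** * Bounds on the terms of a solution *)

Definition solution (s : seq nat) :=
  [/\ all (leq 1) s, sorted leq s & \sum_(a <- s) a%:R^-1 = 1 :> rat].

(** The first [i] terms sum to less than 1, so by Curtiss' theorem at least [1 / u_ i] is left for
    the others. These are at most [size s] in number, none exceeding the reciprocal of the entry at
    index [i]. *)
Lemma solution_nth_le s i : solution s -> (i < size s)%N ->
  (nth 0 s i <= size s * u_ i)%N.
Proof.
move=> [/all_nthP s_gt0 s_sorted]; rewrite (big_nth 0%N) => eq1 i_lt.
have s_mono := sorted_leq_nth leq_trans leqnn 0%N s_sorted.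
rewrite (@big_cat_nat _ _ _ i)//= in eq1; last exact: ltnW.
set A := \sum_(0 <= _ < i) _ in eq1; set B := \sum_(i <= _ < _) _ in eq1.
have si_gt0 : 0 < (nth 0%N s i)%:R :> rat by rewrite ltr0n s_gt0.
have B_gt0 : 0 < B.
  rewrite /B big_ltn// ltr_wpDr ?invr_gt0// sumr_ge0// => l _.
  by rewrite invr_ge0.
have A_le : A <= 1 - (u_ i)%:R^-1.
  rewrite /A big_mkord; apply: (@unit_sum_lt1_le _ (nth 0%N s)) => [l l_i|l l_i|].
  - by apply: s_gt0; lia.
  - by apply: s_mono; rewrite ?inE; lia.
  - by rewrite -(big_mkord xpredT (fun l => (nth 0%N s l)%:R^-1)) -/A; lra.
have B_le : B <= (size s)%:R / (nth 0%N s i)%:R.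
  apply: (@le_trans _ _ (\sum_(i <= l < size s) (nth 0%N s i)%:R^-1)).
    apply: ler_sum_nat => l /andP[i_l l_s].
    rewrite lef_pV2 ?posrE ?ltr0n ?ler_nat ?s_gt0//.
    by apply: s_mono; rewrite ?inE.
  rewrite sumr_const_nat -[leLHS]mulr_natl ler_pM2r ?invr_gt0// ler_nat.
  by rewrite leq_subr.
have : (u_ i)%:R^-1 <= (size s)%:R / (nth 0%N s i)%:R :> rat.
  by apply: le_trans B_le; lra.
rewrite ler_pdivlMr// mulrC ler_pdivrMr ?ltr0n ?u_gt0//.
by rewrite -natrM ler_nat.
Qed.

Lemma solution_split p t : solution (p ++ t) -> t != [::] ->
  let q := foldl subfrac (1, 1)%N p in
  [/\ (0 < q.1)%N, q.2 = (\prod_(a <- p) a)%N, (0 < q.2)%N &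
      q.1%:R / q.2%:R = \sum_(a <- t) a%:R^-1 :> rat].
Proof.
move=> [+ _]; rewrite all_cat => /andP[p_gt0 t_gt0]; rewrite big_cat => /= eq1 t0.
have r_gt0 : 0 < \sum_(a <- t) a%:R^-1 :> rat.
  case: t t_gt0 t0 {eq1} => // a t /= /andP[a_gt0 _] _.
  by rewrite big_cons ltr_wpDr ?invr_gt0 ?ltr0n// sumr_ge0// => i _; rewrite invr_ge0.
have [|q1 q2 eq_r] := foldl_subfrac (m := 1) (n := 1) isT p_gt0 r_gt0.
  by rewrite divr1 eq1.
split=> //; first by rewrite q2 mul1n.
rewrite q2 mul1n big_seq; apply: prodn_cond_gt0 => a /(allP p_gt0).
by [].
Qed.

(** The largest term is at least the average, so [m * a <= 4 * n] and [q1.1 * b <= 3 * (n * a)];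
    hence 12 = 3 * 4, and 48 = 4 * 12 for [q2.2 = n * a * b]. *)
Lemma tail_bounds m n a b x y : (0 < n)%N -> (0 < a)%N -> (a <= b)%N ->
  (b <= x)%N -> (x <= y)%N ->
  m%:R / n%:R = \sum_(z <- [:: a; b; x; y]) z%:R^-1 :> rat ->
  let q1 := subfrac (m, n) a in let q2 := subfrac q1 b in
  [/\ (n < m * a)%N, (0 < q1.1 * b <= 12 * n ^ 2)%N,
      (0 < q2.2 <= 48 * n ^ 4)%N, (q2.2 < q2.1 * x)%N &
      (q2.1 * x - q2.2 %| q2.2 ^ 2)%N].
Proof.
move=> n_gt0 a_gt0 le_ab le_bx le_xy eq_mn q1 q2.
have b_gt0 : (0 < b)%N by lia.
have x_gt0 : (0 < x)%N by lia.
have y_gt0 : (0 < y)%N by lia.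
have sum_gt0 z s : (0 < z)%N -> 0 < \sum_(c <- z :: s) c%:R^-1 :> rat.
  move=> z_gt0; rewrite big_cons ltr_wpDr ?invr_gt0 ?ltr0n// sumr_ge0// => i _.
  by rewrite invr_ge0.
have le_ma : (m * a <= 4 * n)%N.
  by apply: le_first_denominator eq_mn; rewrite //= !andbT; lia.
rewrite big_cons in eq_mn.
have [lt_ma eq_q1] := subfracP n_gt0 a_gt0 (sum_gt0 b _ b_gt0) eq_mn.
have n1_gt0 : (0 < n * a)%N by rewrite muln_gt0 n_gt0.
have le_m1b : ((m * a - n) * b <= 3 * (n * a))%N.
  by apply: le_first_denominator eq_q1; rewrite //= !andbT; lia.
rewrite big_cons in eq_q1.
have [lt_m1b eq_q2] := subfracP n1_gt0 b_gt0 (sum_gt0 x _ x_gt0) eq_q1.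
have n2_gt0 : (0 < n * a * b)%N by rewrite muln_gt0 n1_gt0.
rewrite !big_cons big_nil addr0 in eq_q2.
have yV_gt0 : 0 < y%:R^-1 :> rat by rewrite invr_gt0 ltr0n.
have [lt_m2x _] := subfracP n2_gt0 x_gt0 yV_gt0 eq_q2.
have dvd_n2 := two_unit_fractions n2_gt0 x_gt0 y_gt0 eq_q2.
have m_gt0 : (0 < m)%N by case: (m) lt_ma.
have le_a : (a <= 4 * n)%N by apply: leq_trans le_ma; rewrite leq_pmull.
have le_N : ((m * a - n) * b <= 12 * n ^ 2)%N.
  apply: leq_trans le_m1b _; rewrite (_ : 12 * n ^ 2 = 3 * (n * (4 * n)))%N; last by lia.
  by rewrite !leq_mul.
have m1_gt0 : (0 < m * a - n)%N by rewrite subn_gt0.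
have le_b : (b <= 12 * n ^ 2)%N by apply: leq_trans le_N; rewrite leq_pmull.
split=> //=; first by rewrite muln_gt0 m1_gt0 b_gt0.
rewrite n2_gt0 (_ : 48 * n ^ 4 = n * (4 * n) * (12 * n ^ 2))%N; last by ring.
by rewrite !leq_mul.
Qed.

(** A divisor is stored as its position in the list of divisors, shifted by one to fit into a [box].
    The last denominator is omitted, as the others determine it. *)
Definition code (p : seq nat) (a b x : nat) : seq nat :=
  let q1 := subfrac (foldl subfrac (1, 1)%N p) a in
  let q2 := subfrac q1 b in
  p ++ [:: (q1.1 * b)%N; (index q1.1 (divisors (q1.1 * b))).+1;
    (index (q2.1 * x - q2.2)%N (divisors (q2.2 ^ 2))).+1].

Lemma index_inj_left (T : eqType) (s : seq T) x y :
  x \in s -> index x s = index y s -> x = y.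
Proof.
move=> x_s eq_i; have y_s : y \in s by rewrite -index_mem -eq_i index_mem.
by rewrite -(nth_index x x_s) eq_i nth_index.
Qed.

Lemma solution_tail p a b x y : solution (p ++ [:: a; b; x; y]) ->
  let q := foldl subfrac (1, 1)%N p in
  let q1 := subfrac q a in let q2 := subfrac q1 b in
  [/\ q.2 = (\prod_(c <- p) c)%N /\ (0 < q.1)%N, (q.2 < q.1 * a)%N,
      (0 < q1.1 * b <= 12 * q.2 ^ 2)%N, (0 < q2.2 <= 48 * q.2 ^ 4)%N &
      (q2.2 < q2.1 * x)%N /\ (q2.1 * x - q2.2 %| q2.2 ^ 2)%N].
Proof.
move=> sol; have := solution_split sol isT; case: sol => + + _.
rewrite all_cat => /andP[_ /= /and5P[a_gt0 _ _ _ _]].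
move=> /(subseq_sorted leq_trans (suffix_subseq _ _)) /= /and4P[le_ab le_bx le_xy _].
case: (foldl _ _ p) => m n /= [m_gt0 n_eq n_gt0 eq_mn].
by have [] := tail_bounds n_gt0 a_gt0 le_ab le_bx le_xy eq_mn.
Qed.

(** Decoding goes from left to right: the prefix fixes [m] and [n]; the divisor [m * a - n] of N
    gives [a], its cofactor is [b]; the divisor of the squared denominator then gives [x], and the
    total 1 gives [y]. *)
Lemma code_inj p a b x y p' a' b' x' y' :
  solution (p ++ [:: a; b; x; y]) -> solution (p' ++ [:: a'; b'; x'; y']) ->
  size p = size p' -> code p a b x = code p' a' b' x' ->
  p ++ [:: a; b; x; y] = p' ++ [:: a'; b'; x'; y'].
Proof.
move=> sol sol' eq_size /eqP; rewrite /code eqseq_cat// => /andP[/eqP eq_p].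
have := solution_tail sol'; have := solution_tail sol.
case: sol sol' => _ _ eq1 [_ _ eq1'].
rewrite -eq_p in eq1' *; case: (foldl _ _ p) => m n /=.
move=> [[_ m_gt0] lt_na /andP[N_gt0 _] /andP[n2_gt0 _] [lt_n2x dvd_n2]].
move=> [[_ _] lt_na' _ _ [lt_n2x' _]].
case/eqP => eq_N eq_i eq_d.
have eq_a : a = a'.
  have : (m * a - n = m * a' - n)%N.
    apply: (@index_inj_left _ (divisors ((m * a - n) * b))); last by rewrite {2}eq_N.
    by rewrite -dvdn_divisors// dvdn_mulr.
  move=> eq_m1; apply/eqP; rewrite -(eqn_pmul2l m_gt0); apply/eqP; lia.
rewrite -eq_a in eq_N lt_na' lt_n2x' eq_d eq1' *.
have eq_b : b = b'.
  apply/eqP; move: N_gt0; rewrite muln_gt0 => /andP[m1_gt0 _].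
  by rewrite -(eqn_pmul2l m1_gt0); apply/eqP.
rewrite -eq_b in eq_N lt_n2x' eq_d eq1' *.
have eq_x : x = x'.
  have eq_d' := index_inj_left _ eq_d.
  have {}eq_d : ((((m * a - n) * b - n * a) * x - n * a * b) =
    (((m * a - n) * b - n * a) * x' - n * a * b))%N.
    by apply: eq_d'; rewrite -dvdn_divisors// expn_gt0 n2_gt0.
  have m2_gt0 : (0 < (m * a - n) * b - n * a)%N.
    by move: lt_n2x; case: (_ - n * a)%N.
  by apply/eqP; rewrite -(eqn_pmul2l m2_gt0); apply/eqP; lia.
rewrite -eq_x in eq1' *; suff -> : y = y' by [].
have := etrans eq1' (esym eq1); rewrite !big_cat /= !big_cons big_nil !addr0.
by do 4 move=> /addrI; move=> /invr_inj/eqP; rewrite eqr_nat => /eqP.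
Qed.

Lemma all2_cat (S T : Type) (r : S -> T -> bool) s1 s2 t1 t2 :
  size s1 = size t1 ->
  all2 r (s1 ++ s2) (t1 ++ t2) = all2 r s1 t1 && all2 r s2 t2.
Proof. by elim: s1 t1 => [|x s1 IH] [|y t1]//= [/IH ->]; rewrite andbA. Qed.

(** The product of the [u_ i] is at most that of the [u_ i + 1], which is [u_ j]. *)
Lemma prod_prefix_le j k :
  (\prod_(b <- [seq k * u_ i | i <- iota 0 j]) b <= k ^ j * u_ j)%N.
Proof.
rewrite big_map -{1}(subn0 j) -/(index_iota 0 j) big_mkord big_split /=.
rewrite prod_nat_const card_ord leq_mul2l -u_prod; apply/orP; right.
by apply: leq_prod => i _; rewrite leq_addr.
Qed.

(** The code leaves at most [X] prefixes, [12 * X ^ 2] values of N and [D] positions for each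
    divisor. The range required of [D] covers N as well as the squared denominator. *)
Lemma f_le j D (X := ((j + 4) ^ j * u_ j)%N) :
  (forall n, 0 < n -> n <= (48 * X ^ 4) ^ 2 -> size (divisors n) <= D)%N ->
  (f_ (j + 4) 1 1 <= 12 * X ^ 3 * D ^ 2)%N.
Proof.
move=> D_ge; set k := (j + 4)%N in X D_ge *.
have X_gt0 : (0 < X)%N by rewrite muln_gt0 expn_gt0 u_gt0 addn_gt0 orbT.
pose bs := [seq k * u_ i | i <- iota 0 j]%N.
have prod_bs : (\prod_(b <- bs) b <= X)%N by exact: prod_prefix_le.
have size_bs : size bs = j by rewrite size_map size_iota.
apply: (@leq_trans (size (box (bs ++ [:: 12 * X ^ 2; D; D])%N))); last first.
  rewrite size_box big_cat /= !big_cons big_nil.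
  rewrite (_ : 12 * X ^ 3 * D ^ 2 = X * (12 * X ^ 2 * (D * (D * 1))))%N; last by ring.
  by rewrite leq_mul2r prod_bs orbT.
have solP (s : k.-tuple nat) : @unit_fraction_solutions k 1 1 s -> solution s.
  move=> [s_gt0 s_sorted eq1]; split=> //; first exact: pos_tupleP.
  by rewrite -unit_sumE -eq1 divr1.
have splitP (s : k.-tuple nat) : exists p a b x y,
    s = p ++ [:: a; b; x; y] :> seq nat /\ size p = j.
  have size_p : size (take j s) = j by rewrite size_takel// size_tuple leq_addr.
  have : size (drop j s) = 4 by rewrite size_drop size_tuple addKn.
  case E : (drop j s) => [|a [|b [|x [|y []]]]] // _.
  by exists (take j s), a, b, x, y; rewrite -E cat_take_drop.
pose g (s : seq nat) := code (take j s) (nth 0 s j) (nth 0 s j.+1) (nth 0 s j.+2).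
have gE p a b x y : size p = j -> g (p ++ [:: a; b; x; y]) = code p a b x.
  rewrite /g => <-; rewrite take_size_cat// !nth_cat ltnn subnn.
  by rewrite !ltnNge leqnSn (leqW (leqnSn _)) !subSnn subSn// subSnn.
apply: (@card_fset_set_le _ _ _ (fun s : k.-tuple nat => g s)).
- exact: finite_unit_fraction_solutions.
- move=> s /solP; have [p [a [b [x [y [-> size_p]]]]]] := splitP s.
  rewrite gE// => sol.
  have := solution_tail sol; rewrite /code mem_box.
  have p_le i : (i < j)%N -> (nth 0 p i <= k * u_ i)%N.
    move=> i_j; have := @solution_nth_le _ i sol.
    rewrite size_cat size_p nth_cat size_p i_j; apply.
    by rewrite ltn_addr.
  have all2_p : all2 (fun x b => 0 < x <= b)%N p bs.
    have p_gt0 : all (leq 1) p by case: sol; rewrite all_cat => /andP[].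
    rewrite all2E size_p size_bs eqxx /=.
    apply/(all_nthP (0, 0)%N) => i; rewrite size_zip size_p size_bs minnn => i_j.
    rewrite nth_zip ?size_p//= (all_nthP 0%N p_gt0) ?size_p//=.
    by rewrite (nth_map 0%N) ?size_iota// nth_iota// p_le.
  have p_prod : (\prod_(c <- p) c <= X)%N.
    apply: leq_trans prod_bs.
    rewrite [leqLHS](big_nth 0%N) [leqRHS](big_nth 0%N) size_p size_bs !big_mkord.
    apply: leq_prod => i _; rewrite (nth_map 0%N) ?size_iota// nth_iota//.
    exact: p_le.
  case: (foldl _ _ p) => m n /= [[-> _] _ N_le n2_le [_ dvd_n2]].
  rewrite all2_cat ?size_p// all2_p /=.
  set n' := (\prod_(c <- p) c)%N in p_prod N_le n2_le dvd_n2 *.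
  set N := ((m * a - n') * b)%N in N_le *.
  set n2 := (n' * a * b)%N in n2_le dvd_n2 *.
  have /andP[N_gt0 N_le'] := N_le; have /andP[n2_gt0 n2_le'] := n2_le.
  have le_X e : (n' ^ e <= X ^ e)%N by exact: leq_expl.
  rewrite N_gt0 (leq_trans N_le') ?leq_mul2l ?le_X//= andbT.
  have index_le d c : (0 < c <= (48 * X ^ 4) ^ 2)%N -> (d %| c)%N ->
      (index d (divisors c) < D)%N.
    move=> /andP[c_gt0 c_le] dvd_c; apply: leq_trans (D_ge _ c_gt0 c_le).
    by rewrite index_mem -dvdn_divisors.
  rewrite !index_le ?dvd_n2 ?dvdn_mulr// ?N_gt0 ?expn_gt0 ?n2_gt0//=.
  + by rewrite leq_expl// (leq_trans n2_le')// leq_mul2l le_X.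
  + apply: (leq_trans N_le'); rewrite expnMn -expnM leq_mul//.
    by rewrite (leq_trans (le_X 2))// leq_pexp2l.
- move=> s s' /solP sol /solP sol' eq_g; apply: val_inj => /=.
  move: sol sol' eq_g; have [p [a [b [x [y [-> size_p]]]]]] := splitP s.
  have [p' [a' [b' [x' [y' [-> size_p']]]]]] := splitP s'.
  rewrite !gE// => sol sol'; apply: code_inj sol sol' _.
  by rewrite size_p.
Qed.

(** * The growth of the number of solutions *)

(** Taking for [D] the largest divisor count in the range of [f_le], [divisor_bound] gives
    [D ^ t <= C * (48 * X ^ 4) ^ 2]. The two factors [D] thus contribute [X ^ 16] to the [t]-th
    power. *)
Lemma f_expn_le t : (0 < t)%N -> exists K : nat, forall j,
  (f_ (j + 4) 1 1 ^ t <= K * ((j + 4) ^ j * u_ j) ^ (3 * t + 16))%N.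
Proof.
move=> t_gt0; have [C HC] := divisor_bound t_gt0.
exists (12 ^ t * (C * 48 ^ 2) ^ 2)%N => j; set X := ((j + 4) ^ j * u_ j)%N.
pose B := ((48 * X ^ 4) ^ 2)%N.
pose D := (\max_(n < B.+1 | 0 < n) size (divisors n))%N.
have D_le : (D ^ t <= C * B)%N.
  apply: (big_ind (fun d => d ^ t <= C * B)%N); first by rewrite exp0n.
    by move=> d e d_le e_le; rewrite /maxn; case: ifP.
  move=> n n_gt0; apply: leq_trans (HC _ n_gt0) _.
  by rewrite leq_mul2l -ltnS ltn_ord orbT.
have f_le_D : (f_ (j + 4) 1 1 <= 12 * X ^ 3 * D ^ 2)%N.
  apply: f_le => n n_gt0 n_le; have n_B : (n < B.+1)%N by [].
  exact: (leq_bigmax_cond (F := fun n : 'I_B.+1 => size (divisors n))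
            (Ordinal n_B) n_gt0).
apply: leq_trans (leq_expl t f_le_D) _.
apply: (@leq_trans (12 ^ t * X ^ (3 * t) * (C * B) ^ 2)%N).
  by rewrite 2!expnMn -(expnM X) leq_mul// -expnM mulnC expnM leq_expl.
rewrite /B expnD; move: (12 ^ t)%N (X ^ (3 * t))%N => a b.
by rewrite eq_leq//; ring.
Qed.

(** By [j + 4 <= 2 ^ (j + 4)] the left side is less than a power of 2 whose exponent is quadratic in
    [j]. This absorbs the factors [k ^ O(k)]. *)
Lemma expn_expn_bound K c : exists J, forall j, (J <= j)%N ->
  (K * (j + 4) ^ (c * (j + 4)) < 4 ^ 2 ^ j)%N.
Proof.
(* 27 comes from [j.+1 ^ 3 <= 27 * 2 ^ j], and 16 from [(j + 4) ^ 2 <= 16 * j.+1 ^ 2]. *)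
exists (27 * (K + 16 * c))%N => j j_ge.
have cube : (j.+1 ^ 3 <= 3 ^ 3 * 2 ^ j)%N by exact: expn_succ_le.
have exponent_le : (K + (j + 4) * (c * (j + 4)) <= 2 * 2 ^ j)%N.
  have : (27 * (K + 16 * c) * j.+1 ^ 2 <= j.+1 ^ 3)%N.
    by rewrite [leqRHS]expnS leq_mul2r ltnW ?orbT.
  move: cube j_ge; nia.
apply: (@leq_trans (2 ^ (2 * 2 ^ j))); last by rewrite expnM.
apply: leq_trans (leq_pexp2l _ exponent_le) => //; rewrite expnD.
apply: (@leq_ltn_trans (K * 2 ^ ((j + 4) * (c * (j + 4))))).
  by rewrite leq_mul2l [leqRHS]expnM leq_expl ?orbT// ltnW// ltn_expl.
by rewrite ltn_pmul2r ?expn_gt0// ltn_expl.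
Qed.

(** * Comparison with powers of [c0] *)

Lemma c0_seqX (R : realType) n : c0_seq R n ^+ (2 ^ n) = (u_ n)%:R.
Proof.
rewrite /c0_seq -powR_mulrn ?powR_ge0// -powRrM natrX mulVf ?powRr1//.
by rewrite expf_neq0// pnatr_eq0.
Qed.

(** The sequence is nondecreasing because [u_ n.+1 >= u_ n ^ 2], so its limit bounds every term. *)
Lemma c0_seq_le_c0 (R : realType) n : c0_seq R n <= c0 R.
Proof.
apply: nondecreasing_cvgn_le; last exact: is_cvg_c0_seq.
apply/nondecreasing_seqP => m.
rewrite -(@ler_pXn2r _ (2 ^ m.+1)) ?expn_gt0 ?nnegrE ?powR_ge0//.
rewrite c0_seqX expnSr exprM c0_seqX -natrX ler_nat /= expnS expn1.
by rewrite leq_mul// leq_addr.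
Qed.

Lemma u_le_c0 (R : realType) n : (u_ n)%:R <= c0 R ^+ (2 ^ n).
Proof.
have := c0_seq_le_c0 R n; rewrite -c0_seqX.
by apply: lerXn2r; rewrite ?nnegrE ?(le_trans _ (c0_seq_le_c0 R n)) ?powR_ge0.
Qed.

Lemma c0_le2 (R : realType) : c0 R <= 2.
Proof.
apply: limr_le; first exact: is_cvg_c0_seq.
apply: nearW => n; rewrite -(@ler_pXn2r _ (2 ^ n)) ?expn_gt0 ?nnegrE ?powR_ge0//.
by rewrite c0_seqX -natrX ler_nat ltnW// u_lt.
Qed.

Lemma c0_gt1 (R : realType) : 1 < c0 R.
Proof.
apply: lt_le_trans (c0_seq_le_c0 R 1).
rewrite -(@ltr_pXn2r _ (2 ^ 1)) ?nnegrE ?powR_ge0//.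
by rewrite c0_seqX expr1n ltr1n.
Qed.

(** All three bounds follow from this one; the factor [k ^ k] pays for the orderings of the terms in
    the product equation. *)
Lemma f_mul_expn_lt (R : realType) : exists K : nat, forall k, (K <= k)%N ->
  (f_ k 1 1 * k ^ k)%N%:R < c0 R `^ (2 / 5 * 2 ^+ (k - 1)).
Proof.
(* With [t = 100] the exponent of [u_ j] is 3 + 16/100 = 3.16, below the available (2/5) * 8 =
   3.2. *)
have [M f_leM] := @f_expn_le 100 isT.
(* The powers of [k = j + 4] collect to the exponent [316 * j + 100 * k <= 500 * k]. *)
have [J lt_J] := expn_expn_bound M 500.
exists (J + 4)%N => k k_ge.
have [j k_eq] : exists j, k = (j + 4)%N by exists (k - 4)%N; lia.
have {k_ge}/lt_J {}lt_J : (J <= j)%N by lia.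
rewrite {}k_eq.
have c_ge0 : 0 <= c0 R by rewrite ltW// (lt_trans _ (c0_gt1 R)).
rewrite -(@ltr_pXn2r _ 100) ?nnegrE ?powR_ge0// -[ltRHS]powR_mulrn ?powR_ge0//.
rewrite -powRrM (_ : _ * _ * 100%:R = (320 * 2 ^ j)%N%:R); last first.
  by rewrite -addnBA// exprD natrM natrX; lra.
rewrite powR_mulrn// -natrX.
apply: (@lt_le_trans _ _ ((4 ^ 2 ^ j * u_ j ^ 316)%N%:R)).
  rewrite ltr_nat; apply: (@leq_ltn_trans
      (M * (j + 4) ^ (500 * (j + 4)) * u_ j ^ 316)); last first.
    by rewrite ltn_pmul2r ?expn_gt0 ?u_gt0.
  rewrite expnMn; apply: leq_trans (leq_mul (f_leM j) (leqnn _)) _.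
  rewrite (_ : 3 * 100 + 16 = 316)%N// expnMn; move: (u_ j ^ 316)%N => U.
  rewrite -!expnM -!mulnA leq_mul2l; apply/orP; right.
  rewrite mulnCA mulnC leq_mul2r -expnD leq_pexp2l ?orbT ?addn_gt0 ?orbT//.
  lia.
(* The margin 320 - 316 = 4 in the exponent suffices, as [c0 ^ 2 >= u_ 1 = 2]. *)
have c0_exp4 : 4%:R <= c0 R ^+ 4.
  by rewrite (natrX _ 2 2) (exprM _ 2 2) lerXn2r ?nnegrE ?exprn_ge0// (u_le_c0 R 1).
rewrite (_ : 320 * 2 ^ j = 4 * 2 ^ j + 2 ^ j * 316)%N; last by lia.
rewrite natrM !natrX exprD !exprM ler_pM ?exprn_ge0// lerXn2r ?nnegrE ?exprn_ge0//.
exact: u_le_c0.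
Qed.

(** * Reduction of the product equation to unit fractions *)

Lemma all2_nseq (S T : Type) (r : S -> T -> bool) s (y : T) :
  all2 r s (nseq (size s) y) = all (r^~ y) s.
Proof. by elim: s => //= x s ->. Qed.

(** Sorting loses the order of the terms; recording for each term its position in the sorted list,
    one of [k] values, restores it. *)
Lemma product_equation_count_le k :
  (product_equation_count k <= f_ k.+1 1 1 * k ^ k)%N.
Proof.
pose S := fset_set (@unit_fraction_solutions k.+1 1 1).
pose srt (a : seq nat) := rcons (sort leq a) (\prod_(x <- a) x)%N.
pose g (a : seq nat) := (srt a, [seq (index x (sort leq a)).+1 | x <- a]).
pose L := [seq (s, t) | s <- [seq val a | a <- enum_fset S], t <- box (nseq k k)].
have -> : (f_ k.+1 1 1 * k ^ k)%N = size L.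
  by rewrite size_allpairs size_map size_box big_nseq iter_muln_1.
apply: (@card_fset_set_le _ _ _ (fun a : k.-tuple nat => g a)).
- exact: finite_product_equation_solutions.
- move=> a [a_gt0 eq1]; apply: allpairs_f.
    have size_srt : size (srt a) == k.+1 by rewrite size_rcons size_sort size_tuple.
    apply/mapP; exists (Tuple size_srt) => //.
    rewrite in_fset_set ?inE; last exact: finite_unit_fraction_solutions.
    have prod_gt0 : (0 < \prod_(x <- a) x)%N by rewrite big_tuple prodn_gt0.
    split.
    + move=> i; have /allP : all (leq 1) (srt a).
        by rewrite all_rcons prod_gt0 all_sort pos_tupleP.
      by apply; exact: mem_tnth.
    (* The product may stand last because every term divides it. *)
    + rewrite /= (sorted_pairwise leq_trans) pairwise_rcons.
      rewrite -(sorted_pairwise leq_trans) sort_sorted ?andbT; last exact: leq_total.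
      apply/allP => x; rewrite mem_sort => x_a; apply: dvdn_leq => //.
      by rewrite (big_rem x x_a) dvdn_mulr.
    + rewrite divr1; apply: (etrans eq1).
      rewrite !unit_sumE /= /srt -cats1 big_cat big_seq1.
      congr (_ + _^-1); last by rewrite natr_prod big_tuple.
      by apply: perm_big; rewrite perm_sym perm_sort.
  rewrite mem_box -[X in nseq X _](size_tuple a).
  rewrite -(size_map (fun x => (index x (sort leq a)).+1)) all2_nseq all_map; apply/allP => x x_a /=.
  by rewrite -[X in (_ <= X)%N](size_tuple a) -(size_sort leq) index_mem mem_sort.
- move=> a b _ _ [/rcons_inj[eq_s _] eq_i]; apply: val_inj => /=.
  (* Repeated terms share the first position, which is harmless because only the value found there
     matters. *)
  have decode (c : seq nat) :
      c = [seq nth 0 (sort leq c) i.-1 | i <- [seq (index x (sort leq c)).+1 | x <- c]]%N.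
    rewrite -map_comp -[LHS]map_id; apply/eq_in_map => x x_c /=.
    by rewrite nth_index// mem_sort.
  by rewrite (decode a) eq_i eq_s -decode.
Qed.

Theorem corollary3 (R : realType) :
  (forall eps : R, 0 < eps ->
     exists C : R, 0 < C /\
       forall k : nat, (0 < k)%N ->
         (f_ k 1 1)%:R <= C * k%:R `^ (2 / 15 * 2 ^+ (k - 1) + eps))
  /\
  (forall eps : R, 0 < eps ->
     exists K : nat, (0 < K)%N /\
       forall k : nat, (K <= k)%N ->
         (f_ k 1 1)%:R < c0 R `^ ((2 / 5 + eps) * 2 ^+ (k - 1)))
  /\
  (forall eps : R, 0 < eps ->
     exists K : nat, (0 < K)%N /\
       forall k : nat, (K <= k)%N ->
         (product_equation_count k)%:R <= c0 R `^ ((2 / 5 + eps) * 2 ^+ k)).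
Proof.
have [K lt_K] := f_mul_expn_lt R.
have f_le_mul k : (f_ k 1 1 <= f_ k 1 1 * k ^ k)%N.
  by rewrite leq_pmulr// expn_gt0; case: k.
have le_c0 eps k : 0 < eps ->
    c0 R `^ (2 / 5 * 2 ^+ k) <= c0 R `^ ((2 / 5 + eps) * 2 ^+ k).
  move=> eps_gt0; rewrite ler_powR ?(ltW (c0_gt1 R))//.
  by rewrite ler_pM2r ?exprn_gt0// lerDl ltW.
split; [|split] => eps eps_gt0.
(* From 8 on, [k ^ (1/3) >= 2 >= c0]; the finitely many smaller [k] are absorbed into the
   constant. *)
- pose N := maxn K 8.
  exists (1 + \sum_(i < N) (f_ i 1 1)%:R); split.
    by rewrite ltr_wpDr// sumr_ge0.
  move=> k k_gt0; set C := 1 + _; set e := _ + eps.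
  have C_ge1 : 1 <= C by rewrite lerDl sumr_ge0.
  have C_ge0 := le_trans ler01 C_ge1.
  have k_ge1 : 1 <= k%:R :> R by rewrite ler1n.
  have e_ge0 : 0 <= e.
    by rewrite addr_ge0 ?(ltW eps_gt0)// mulr_ge0 ?exprn_ge0// divr_ge0.
  have k_powR_ge1 : 1 <= k%:R `^ e by have := ler_powR k_ge1 e_ge0; rewrite powRr0.
  have [k_lt|k_ge] := ltnP k N.
    apply: (@le_trans _ _ C); last by rewrite ler_peMr.
    rewrite /C (bigD1 (Ordinal k_lt))//= addrCA lerDl addr_ge0//.
    exact: sumr_ge0.
  apply: (@le_trans _ _ (k%:R `^ e)); last by rewrite ler_peMl// powR_ge0.
  have k_ge8 : (8 <= k)%N by apply: leq_trans k_ge; exact: leq_maxr.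
  have c0_le : c0 R <= k%:R `^ 3^-1.
    apply: (le_trans (c0_le2 R)); apply: (@le_trans _ _ (8 `^ 3^-1)).
      have -> : 8 = 2 `^ 3 :> R by rewrite powR_mulrn// -natrX.
      by rewrite -powRrM divff ?powRr1// pnatr_eq0.
    by rewrite ge0_ler_powR ?nnegrE ?invr_ge0 ?ler_nat.
  have /ltW le_f := lt_K k (leq_trans (leq_maxl _ _) k_ge).
  apply: (@le_trans _ _ (f_ k 1 1 * k ^ k)%N%:R); first by rewrite ler_nat.
  apply: (le_trans le_f).
  apply: (@le_trans _ _ ((k%:R `^ 3^-1) `^ (2 / 5 * 2 ^+ (k - 1)))).
    have c0_ge0 : 0 <= c0 R by rewrite (le_trans ler01)// ltW// c0_gt1.
    by rewrite ge0_ler_powR ?nnegrE ?powR_ge0// mulr_ge0 ?exprn_ge0// divr_ge0.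
  (* The exponent is (1/3) * (2/5) = 2/15. *)
  rewrite -powRrM ler_powR// /e.
  move: (2 ^+ (k - 1)) => z; lra.
- exists K.+1; split=> // k /ltnW k_ge.
  apply: lt_le_trans (le_c0 _ _ eps_gt0); apply: le_lt_trans (lt_K k k_ge).
  by rewrite ler_nat.
- exists K.+1; split=> // k /ltnW k_ge.
  apply: le_trans (le_c0 _ _ eps_gt0).
  (* Sorted solutions have [k.+1] terms, which turns the exponent [2 ^ (k - 1)] into [2 ^ k]. *)
  have := lt_K k.+1 (leqW k_ge); rewrite subn1 => /ltW; apply: le_trans.
  rewrite ler_nat; apply: leq_trans (product_equation_count_le k) _.
  rewrite leq_mul2l; apply/orP; right.
  exact: leq_trans (leq_expl _ (leqnSn k)) (leq_pexp2l _ (leqnSn k)).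
Qed.
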